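(* Let $A\in\mathbb{R}^{n\times n}$ be symmetric and positive definite, let $b,x_0\in\mathbb{R}^{n\times m}$, $r_0=b-Ax_0$, and let $k\ge1$ be such that $\dim\mathcal{K}_{k+1}(A,r_0)=(k+1)m$. Consider the quantities determined by the O'Leary block CG algorithm (OL-BCG) applied to $A,b,x_0$, and let $\sigma_0=\mathtt{chol}(r_0^Tr_0)$, $\beta_1=\sigma_0$, $\theta_0=I$, and $\ell_0=0$. Then, for $j=1,\dots,k$, the block Lanczos coefficients $\alpha_j$ and $\beta_{j+1}$ (of the block Lanczos algorithm started with $A$ and $v=r_0$) forming $T_k$, and the coefficients $\ell_j$ and $d_j$ from the factorization $T_k=L_kD_kL_k^T$, where $L_k$ is block lower bidiagonal with identity diagonal blocks and subdiagonal blocks $\ell_1,\dots,\ell_{k-1}$, and $D_k=\mathrm{diag}(d_1,\dots,d_k)$ is block diagonal, can be computed using the recurrences \[ \begin{aligned} \tau_j&=\gamma_{j-1}^{-1}\phi_{j-1}^{-1}\sigma_{j-1}^{-1}\theta_{j-1},\\ d_j&=\theta_{j-1}^T\sigma_{j-1}\tau_j,\\ \alpha_j&=d_j+\ell_{j-1}\beta_j^T,\\ \sigma_j&=\mathtt{chol}(r_j^Tr_j),\\ [\theta_j,\beta_{j+1}]&=\mathtt{qr}(\sigma_j\tau_j),\\ \ell_j&=\theta_j^T\sigma_j\sigma_{j-1}^{-1}\theta_{j-1}. \end{aligned} \] The Lanczos block $v_{k+1}$ can be obtained from $r_k$ as \[ v_{k+1}=(-1)^kr_k\sigma_k^{-1}\theta_k^{-T}.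 \]
   Context: All computations are in exact arithmetic. $I$ denotes the $m\times m$ identity matrix. For $v\in\mathbb{R}^{n\times m}$, $\mathcal{K}_k(A,v)=\mathrm{colspan}\{v,Av,\dots,A^{k-1}v\}$ is the span of all columns of the blocks $v,Av,\dots,A^{k-1}v$. Notation: $[Q,R]=\mathtt{qr}(B)$ means that $B=QR$ is the QR factorization of a full column rank matrix $B$ with $m$ columns, where $Q$ has orthonormal columns and has the same size as $B$, and $R$ is $m\times m$ upper triangular with positive diagonal entries. For a symmetric positive definite $G$, $\mathtt{chol}(G)$ is the upper triangular matrix $R$ with positive diagonal such that $R^TR=G$. Block Lanczos algorithm (input: symmetric $A$, $v\in\mathbb{R}^{n\times m}$): $v_0=0$; $[v_1,\beta_1]=\mathtt{qr}(v)$; for $k=1,2,\dots$: $w=Av_k-v_{k-1}\beta_k^T$; $\alpha_k=v_k^Tw$; $w\leftarrow w-v_k\alpha_k$; $[v_{k+1},\beta_{k+1}]=\mathtt{qr}(w)$. The matrix $T_k\in\mathbb{R}^{km\times km}$ is the symmetric block tridiagonal matrix with diagonal blocks $\alpha_1,\dots,\alpha_k$, subdiagonal blocks $\beta_2,\dots,\beta_k$ and superdiagonal blocks $\beta_2^T,\dots,\beta_k^T$. O'Leary block CG algorithm (OL-BCG) (input: symmetric positive definite $A$, $b\in\mathbb{R}^{n\times m}$, $x_0\in\mathbb{R}^{n\times m}$; the nonsingular matrices $\phi_k\in\mathbb{R}^{m\times m}$ can be freely chosen): $r_0=b-Ax_0$; $p_0=r_0\phi_0$; for $k=1,2,\dots$: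 $\gamma_{k-1}=(p_{k-1}^TAp_{k-1})^{-1}\phi_{k-1}^Tr_{k-1}^Tr_{k-1}$; $x_k=x_{k-1}+p_{k-1}\gamma_{k-1}$; $r_k=r_{k-1}-Ap_{k-1}\gamma_{k-1}$; $\delta_k=\phi_{k-1}^{-1}(r_{k-1}^Tr_{k-1})^{-1}r_k^Tr_k$; $p_k=(r_k+p_{k-1}\delta_k)\phi_k$. The coefficients with index $k$ are understood as belonging to the next matrices ($\beta_{k+1}$ to $T_{k+1}$, $\ell_k$ to $L_{k+1}$). *)

(* Defs.v *)
From mathcomp Require Import all_boot all_order all_algebra.
From mathcomp Require Export classical_sets reals.

Set Implicit Arguments.
Unset Strict Implicit.
Unset Printing Implicit Defensive.

Import Order.TTheory GRing.Theory Num.Theory.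
Local Open Scope classical_set_scope.
Local Open Scope ring_scope.

Definition posdef (R : realType) (n : nat) (G : 'M[R]_n) : Prop :=
  G^T = G /\ forall x : 'cV[R]_n, x != 0 -> 0 < (x^T *m G *m x) 0 0.

(* is_trig_mx means lower triangular in MathComp, hence the transpose. *)
Definition upper_pos (R : realType) (m : nat) (U : 'M[R]_m) : Prop :=
  is_trig_mx U^T /\ forall i, 0 < U i i.

Definition is_chol (R : realType) (m : nat) (G U : 'M[R]_m) : Prop :=
  upper_pos U /\ U^T *m U = G.

Definition is_qr (R : realType) (n m : nat) (B Q : 'M[R]_(n, m)) (U : 'M[R]_m)
  : Prop :=
  [/\ B = Q *m U, Q^T *m Q = 1%:M & upper_pos U].

(* chol and qr are total: they return 0 when no factorization exists, i.e. when
   G is not positive definite, resp. B is not of full column rank. *)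
Definition chol (R : realType) (m : nat) (G : 'M[R]_m) : 'M[R]_m :=
  xget 0 [set U | is_chol G U].

Definition qr (R : realType) (n m : nat) (B : 'M[R]_(n, m))
  : 'M[R]_(n, m) * 'M[R]_m :=
  xget (0, 0) [set QU | is_qr B QU.1 QU.2].

(* Subspaces are row spaces in MathComp, so the column span is represented by
   the row space of the transposed blocks; \rank of the result is its
   dimension. *)
Definition krylov (R : realType) (n m : nat) (A : 'M[R]_n) (v : 'M[R]_(n, m))
  (k : nat) : 'M[R]_n :=
  (\sum_(i < k) <<(A ^+ i *m v)^T>>)%MS.

Definition lanczos_alpha_of (R : realType) (n m : nat) (A : 'M[R]_n)
  (vprev v : 'M[R]_(n, m)) (beta : 'M[R]_m) : 'M[R]_m :=
  v^T *m (A *m v - vprev *m beta^T).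

Definition lanczos_w_of (R : realType) (n m : nat) (A : 'M[R]_n)
  (vprev v : 'M[R]_(n, m)) (beta : 'M[R]_m) : 'M[R]_(n, m) :=
  (A *m v - vprev *m beta^T) - v *m lanczos_alpha_of A vprev v beta.

(* The triple (v_k, v_{k+1}, beta_{k+1}), with v_0 = 0. *)
Fixpoint lanczos (R : realType) (n m : nat) (A : 'M[R]_n) (v : 'M[R]_(n, m))
  (k : nat) : 'M[R]_(n, m) * 'M[R]_(n, m) * 'M[R]_m :=
  if k is j.+1 then
    let: (vprev, vcur, beta) := lanczos A v j in
    let: (vnext, betanext) := qr (lanczos_w_of A vprev vcur beta) in
    (vcur, vnext, betanext)
  else
    let: (v1, beta1) := qr v in (0, v1, beta1).

Definition lanczos_v (R : realType) (n m : nat) (A : 'M[R]_n)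
  (v : 'M[R]_(n, m)) (k : nat) : 'M[R]_(n, m) :=
  (lanczos A v k).1.1.

(* lanczos_beta, lanczos_alpha and lanczos_w are meaningful for k >= 1 only. *)
Definition lanczos_beta (R : realType) (n m : nat) (A : 'M[R]_n)
  (v : 'M[R]_(n, m)) (k : nat) : 'M[R]_m :=
  (lanczos A v k.-1).2.

Definition lanczos_alpha (R : realType) (n m : nat) (A : 'M[R]_n)
  (v : 'M[R]_(n, m)) (k : nat) : 'M[R]_m :=
  lanczos_alpha_of A (lanczos_v A v k.-1) (lanczos_v A v k) (lanczos_beta A v k).

(* The matrix w whose QR factorization gives v_{k+1} and beta_{k+1}. *)
Definition lanczos_w (R : realType) (n m : nat) (A : 'M[R]_n)
  (v : 'M[R]_(n, m)) (k : nat) : 'M[R]_(n, m) :=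
  lanczos_w_of A (lanczos_v A v k.-1) (lanczos_v A v k) (lanczos_beta A v k).

Definition olbcg_gamma_of (R : realType) (n m : nat) (A : 'M[R]_n)
  (phi : 'M[R]_m) (r p : 'M[R]_(n, m)) : 'M[R]_m :=
  invmx (p^T *m A *m p) *m phi^T *m (r^T *m r).

(* The triple (x_k, r_k, p_k). *)
Fixpoint olbcg (R : realType) (n m : nat) (A : 'M[R]_n)
  (b x0 : 'M[R]_(n, m)) (phi : nat -> 'M[R]_m) (k : nat)
  : 'M[R]_(n, m) * 'M[R]_(n, m) * 'M[R]_(n, m) :=
  if k is j.+1 then
    let: (x, r, p) := olbcg A b x0 phi j in
    let gamma := olbcg_gamma_of A (phi j) r p in
    let x' := x + p *m gamma in
    let r' := r - A *m p *m gamma in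
    let delta := invmx (phi j) *m invmx (r^T *m r) *m (r'^T *m r') in
    (x', r', (r' + p *m delta) *m phi j.+1)
  else
    let r0 := b - A *m x0 in (x0, r0, r0 *m phi 0%N).

Definition olbcg_r (R : realType) (n m : nat) (A : 'M[R]_n)
  (b x0 : 'M[R]_(n, m)) (phi : nat -> 'M[R]_m) (k : nat) : 'M[R]_(n, m) :=
  (olbcg A b x0 phi k).1.2.

Definition olbcg_p (R : realType) (n m : nat) (A : 'M[R]_n)
  (b x0 : 'M[R]_(n, m)) (phi : nat -> 'M[R]_m) (k : nat) : 'M[R]_(n, m) :=
  (olbcg A b x0 phi k).2.

Definition olbcg_gamma (R : realType) (n m : nat) (A : 'M[R]_n)
  (b x0 : 'M[R]_(n, m)) (phi : nat -> 'M[R]_m) (k : nat) : 'M[R]_m :=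
  olbcg_gamma_of A (phi k) (olbcg_r A b x0 phi k) (olbcg_p A b x0 phi k).

(* The coefficient sequences alpha, beta, d, ell are indexed from 1, whereas the
   block indices i, j below start at 0. *)
Definition block_tridiag (R : realType) (m : nat) (alpha beta : nat -> 'M[R]_m)
  (k : nat) :=
  \mxblock_(i < k, j < k)
    (if i == j :> nat then alpha i.+1
     else if i == j.+1 :> nat then beta i.+1
     else if j == i.+1 :> nat then (beta j.+1)^T
     else 0 : 'M[R]_m).

Definition block_bidiag (R : realType) (m : nat) (ell : nat -> 'M[R]_m)
  (k : nat) :=
  \mxblock_(i < k, j < k)
    (if i == j :> nat then 1%:M
     else if i == j.+1 :> nat then ell j.+1
     else 0 : 'M[R]_m).

Definition block_diag (R : realType) (m : nat) (d : nat -> 'M[R]_m) (k : nat) :=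
  \mxdiag_(i < k) (d i.+1 : 'M[R]_m).

Definition is_block_ldl (R : realType) (m : nat)
  (alpha beta ell d : nat -> 'M[R]_m) (k : nat) : Prop :=
  block_tridiag alpha beta k =
  block_bidiag ell k *m block_diag d k *m (block_bidiag ell k)^T.

(* Main.v *)
(* Local orthogonality (r_j^T r_{j+1} = 0 and p_j^T A p_{j+1} = 0) follows by a
   one-step induction as long as the residuals have full column rank; they do,
   since r_0, ..., r_j then span the Krylov space, whose dimension is maximal.
   Normalizing residuals and directions by V_j = (-1)^j r_j sigma_j^-1 theta_j and
   S_j = (-1)^j p_j phi_j^-1 sigma_j^-1 theta_j turns the two coupled recurrences
   of OL-BCG into V = S L^T and A S = V L D (plus a last column V_k beta_{k+1}).
   Eliminating S gives a three-term recurrence A V = V (L D L^T) with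
   orthonormal blocks, consecutive ones orthogonal, and subdiagonal coefficients
   that are upper triangular with positive diagonal: by uniqueness of the QR
   factorization it is the block Lanczos recurrence. *)
Require Import Defs.
From mathcomp Require Import all_boot all_order all_algebra.

Set Implicit Arguments.
Unset Strict Implicit.
Unset Printing Implicit Defensive.

Import Order.TTheory GRing.Theory Num.Theory.
Local Open Scope ring_scope.

(** * Cholesky and QR factorizations *)

Lemma upper_pos_unit (R : realType) (m : nat) (U : 'M[R]_m) :
  upper_pos U -> U \in unitmx.
Proof.
case=> tU pU; rewrite unitmxE -det_tr (det_trig tU) unitfE.
by apply/prodf_neq0 => i _; rewrite mxE gt_eqF.
Qed.

(** Peels off the first row and column, so that Cholesky factors can be handled by induction on the
    size. *)
Lemma upper_pos_block (R : realType) (m : nat) (u : 'M[R]_1) (x : 'rV[R]_m)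
    (y : 'cV[R]_m) (U : 'M[R]_m) :
  upper_pos (block_mx u x y U) <-> [/\ 0 < u 0 0, y = 0 & upper_pos U].
Proof.
rewrite /upper_pos tr_block_mx is_trig_block_mx // trmx_eq0.
split=> [[/and3P[/eqP y0 _ tU] pU]|[u0 /eqP y0 [tU pU]]].
  split=> //; first by have := pU (lshift m 0); rewrite block_mxEul.
  by split=> // i; have := pU (rshift 1 i); rewrite block_mxEdr.
split; first by rewrite y0 tU mx11_is_trig.
by move=> i; case: (split_ordP i) => j ->; rewrite ?block_mxEul ?block_mxEdr // ord1.
Qed.

Lemma mx11_mulE (R : pzRingType) (u w : 'M[R]_1) : u *m w = (u 0 0 * w 0 0)%:M.
Proof. by rewrite {1}[u]mx11_scalar {1}[w]mx11_scalar -scalar_mxM. Qed.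

(** The corner of the product is the square of a positive number and fixes that number. Cancelling
    it in the first row fixes the rest of the row, and the trailing blocks then have equal
    products. *)
Lemma chol_uniq (R : realType) (m : nat) (U W : 'M[R]_m) :
  upper_pos U -> upper_pos W -> U^T *m U = W^T *m W -> U = W.
Proof.
elim: m U W => [|m IHm]; first by move=> U W; rewrite [U]thinmx0 [W]thinmx0.
rewrite -[m.+1]/(1 + m)%N => U W; rewrite -[U]submxK -[W]submxK.
move: (ulsubmx _) (ursubmx _) (dlsubmx _) (drsubmx _) => u x y U'.
move: (ulsubmx _) (ursubmx _) (dlsubmx _) (drsubmx _) => w x' y' W'.
move=> /upper_pos_block[u0 -> pU] /upper_pos_block[w0 -> pW].
rewrite !tr_block_mx !mulmx_block !trmx0 !mul0mx !mulmx0 !addr0.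
case/eq_block_mx => uu ux _ UU.
have uw : u = w.
  rewrite [u]mx11_scalar [w]mx11_scalar; congr (_%:M).
  move: uu; rewrite !mx11_mulE !mxE -!expr2 => /(congr1 (fun M : 'M_1 => M 0 0)).
  by rewrite !mxE !mulr1n => /eqP; rewrite eqrXn2 ?ltW // => /eqP.
have uU : u^T \in unitmx.
  by rewrite unitmxE det_mx11 mxE unitfE gt_eqF.
have xx : x = x' by apply: (can_inj (mulKmx uU)); rewrite ux uw.
by rewrite uw xx (IHm U' W') //; move: UU; rewrite xx => /addrI.
Qed.

Lemma chol_exists (R : realType) (m : nat) (G : 'M[R]_m) :
  posdef G -> exists U, is_chol G U.
Proof.
elim: m G => [|m IHm].
  move=> G; exists 0; split; last by rewrite [LHS]thinmx0 [RHS]thinmx0.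
  by split=> [|[]//]; apply/is_trig_mxP => -[].
rewrite -[m.+1]/(1 + m)%N => G; rewrite -[G]submxK.
move: (ulsubmx _) (ursubmx _) (dlsubmx _) (drsubmx _) => a g h H [].
(* Symmetry of [G] identifies the lower left block with [g^T]. *)
rewrite tr_block_mx => /eq_block_mx[_ _ <- HT] pG.
have a0 : 0 < a 0 0.
  have := pG (col_mx 1%:M 0); rewrite tr_col_mx mul_row_block mul_row_col.
  rewrite trmx0 trmx1 !mul0mx !mul1mx mulmx0 mulmx1 !addr0; apply.
  by rewrite col_mx_eq0 negb_and oner_eq0.
have aE : a = (a 0 0)%:M by rewrite {1}[a]mx11_scalar.
(* The Schur complement of the pivot, to which the induction hypothesis is applied. *)
pose H' := H - (a 0 0)^-1 *: (g^T *m g).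
have pH' : posdef H'.
  split=> [|x x0]; first by rewrite linearB linearZ /= trmx_mul trmxK HT.
  (* The first entry of the test vector cancels the first component of [G] times it, so the
     quadratic form of [G] there is that of [H'] at [x]. *)
  have := pG (col_mx (- (a 0 0)^-1 *: (g *m x)) x).
  rewrite col_mx_eq0 negb_and x0 orbT => /(_ isT).
  rewrite tr_col_mx mul_row_block mul_row_col {2}aE mul_mx_scalar.
  have zT : (- (a 0 0)^-1 *: (g *m x))^T = - (a 0 0)^-1 *: (x^T *m g^T).
    by rewrite linearZ /= trmx_mul.
  rewrite zT scalerA mulrN mulfV ?gt_eqF // scaleN1r addNr mul0mx add0r.
  by rewrite mulmxBr -scalemxAr mulmxA scaleNr mulNmx -scalemxAl addrC.
have [U [pU UU]] := IHm _ pH'.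
pose s := Num.sqrt (a 0 0).
have s0 : 0 < s by rewrite sqrtr_gt0.
have ss : s * s = a 0 0 by rewrite -expr2 sqr_sqrtr // ltW.
exists (block_mx s%:M (s^-1 *: g) 0 U); split.
  by apply/upper_pos_block; split=> //; rewrite mxE mulr1n.
rewrite tr_block_mx mulmx_block !trmx0 !mul0mx !mulmx0 !addr0 UU.
rewrite tr_scalar_mx -scalar_mxM ss -aE mul_scalar_mx scalerA.
rewrite mulfV ?gt_eqF // scale1r.
rewrite linearZ /= mul_mx_scalar scalerA mulfV ?gt_eqF // scale1r.
rewrite -scalemxAl -scalemxAr scalerA -invfM ss.
by rewrite /H' addrC subrK.
Qed.

Lemma cholP (R : realType) (m : nat) (G : 'M[R]_m) :
  posdef G -> is_chol G (chol G).
Proof. by move=> /chol_exists; apply: xgetPex. Qed.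

(** Orthonormality of [Q] makes [U] a Cholesky factor of [B^T B], hence unique; being invertible, it
    determines [Q]. *)
Lemma is_qr_uniq (R : realType) (n m : nat) (B Q Q' : 'M[R]_(n, m))
    (U U' : 'M[R]_m) :
  is_qr B Q U -> is_qr B Q' U' -> (Q, U) = (Q', U').
Proof.
move=> [BE QQ pU] [BE' QQ' pU'].
have UU : U = U'.
  apply: chol_uniq => //; move: (congr2 mulmx (congr1 trmx BE') BE').
  rewrite {1 2}BE !trmx_mul !mulmxA -(mulmxA U^T) QQ -(mulmxA U'^T) QQ'.
  by rewrite !mulmx1.
rewrite {}UU in BE *; congr (_, _).
by rewrite -[Q](mulmxK (upper_pos_unit pU')) -BE BE' mulmxK // upper_pos_unit.
Qed.

(** Uniqueness lets the choice made by [qr] be computed: exhibiting one factorization suffices. *)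
Lemma qrE (R : realType) (n m : nat) (B Q : 'M[R]_(n, m)) (U : 'M[R]_m) :
  is_qr B Q U -> qr B = (Q, U).
Proof.
move=> hB; have : is_qr B (qr B).1 (qr B).2.
  apply: (@xgetPex _ (0, 0) [set QU | is_qr B QU.1 QU.2]%classic).
  by exists (Q, U).
by move=> /is_qr_uniq/(_ hB); case: (qr B).
Qed.

Lemma posdef_unit (R : realType) (m : nat) (G : 'M[R]_m) :
  posdef G -> G \in unitmx.
Proof.
case=> _ pG; rewrite -row_free_unit -kermx_eq0.
apply/rowV0P => u /sub_kermxP uG; apply/eqP; apply: contraT => u0.
have := pG u^T; rewrite trmx_eq0 trmxK uG mul0mx mxE ltxx => /(_ u0).
by [].
Qed.

Lemma posdef_congr (R : realType) (n m : nat) (G : 'M[R]_n) (B : 'M[R]_(n, m)) :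
  posdef G -> row_free B^T -> posdef (B^T *m G *m B).
Proof.
move=> [GT pG] fB; split=> [|x x0]; first by rewrite !trmx_mul trmxK GT mulmxA.
rewrite !mulmxA -trmx_mul -!mulmxA mulmxA; apply: pG.
apply: contraNneq x0 => Bx0; rewrite -trmx_eq0.
by apply/eqP/(row_free_inj fB); rewrite -trmx_mul Bx0 trmx0 mul0mx.
Qed.

Lemma posdef1 (R : realType) (n : nat) : posdef (1%:M : 'M[R]_n).
Proof.
split=> [|x x0]; first exact: trmx1.
rewrite mulmx1 mxE lt_def sumr_ge0 ?andbT => [|i _]; last first.
  by rewrite mxE -expr2 sqr_ge0.
apply: contraNneq x0 => /psumr_eq0P x0; apply/eqP/colP => i.
have := x0 _ i isT; rewrite !mxE => xx0; apply/eqP.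
by rewrite -[_ == _]orbb -mulf_eq0 xx0 // => j _; rewrite mxE -expr2 sqr_ge0.
Qed.

Lemma posdef_gram (R : realType) (n m : nat) (B : 'M[R]_(n, m)) :
  row_free B^T -> posdef (B^T *m B).
Proof. by move=> /(posdef_congr (posdef1 R n)); rewrite mulmx1. Qed.

(** The Gram matrix is positive definite; its Cholesky factor is the triangular part, and dividing
    [B] by it leaves orthonormal columns. *)
Lemma qrP (R : realType) (n m : nat) (B : 'M[R]_(n, m)) :
  row_free B^T -> is_qr B (qr B).1 (qr B).2.
Proof.
move=> /posdef_gram/chol_exists[U [pU UU]]; have uU := upper_pos_unit pU.
have hB : is_qr B (B *m invmx U) U.
  split; rewrite ?mulmxKV //.
  rewrite trmx_mul -mulmxA (mulmxA _ B) -UU trmx_inv mulmxA mulKmx ?unitmx_tr //.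
  by rewrite mulmxV.
by rewrite (qrE hB).
Qed.

Lemma invmxM (R : comUnitRingType) (m : nat) (X Y : 'M[R]_m) :
  X \in unitmx -> Y \in unitmx -> invmx (X *m Y) = invmx Y *m invmx X.
Proof.
move=> uX uY; rewrite -[RHS](mulmxK (_ : X *m Y \in unitmx)) ?unitmx_mul ?uX //.
by rewrite mulmxA mulmxKV // mulVmx // mul1mx.
Qed.

(** The last conjunct exchanges [theta_k^-T] in the formula for the Lanczos block with [theta_k]. *)
Lemma orthomx_unit (R : comUnitRingType) (m : nat) (Q : 'M[R]_m) :
  Q^T *m Q = 1%:M -> [/\ Q \in unitmx, Q *m Q^T = 1%:M & (invmx Q)^T = Q].
Proof.
move=> QQ; have [_ uQ] := mulmx1_unit QQ.
have QV : invmx Q = Q^T by rewrite -[LHS]mul1mx -QQ mulmxK.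
by rewrite -QV mulmxV // QV trmxK.
Qed.

Lemma is_chol_gram_inv (R : realType) (m : nat) (G U : 'M[R]_m) :
  is_chol G U -> U \in unitmx /\ invmx G = invmx U *m (invmx U)^T.
Proof.
move=> [/upper_pos_unit uU <-]; have uUT : U^T \in unitmx by rewrite unitmx_tr.
by rewrite invmxM // trmx_inv.
Qed.

(** * Block LDL^T factorization of a block tridiagonal matrix *)

(** Indexed by plain naturals, so that index shifts need no ordinals. *)
Definition bidiag_entry (R : realType) (m : nat) (ell : nat -> 'M[R]_m)
    (i j : nat) : 'M[R]_m :=
  if i == j then 1%:M else if i == j.+1 then ell j.+1 else 0.

Lemma sum_bidiag_entry (R : realType) (m : nat) (ell F : nat -> 'M[R]_m)
    (k i : nat) : (i < k)%N ->
  \sum_(l < k) bidiag_entry ell i l *m F l =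
  F i + (if i is i'.+1 then ell i *m F i' else 0).
Proof.
move=> ltik; rewrite (bigD1 (Ordinal ltik)) //= /bidiag_entry eqxx mul1mx.
congr (_ + _); case: i ltik => [|i] ltik.
  apply: big1 => l; rewrite -val_eqE /= => nl0.
  by rewrite eq_sym (negPf nl0) /= mul0mx.
rewrite (bigD1 (Ordinal (ltnW ltik))) /=; last by rewrite -val_eqE /= neq_ltn ltnSn.
rewrite (gtn_eqF (ltnSn i)) eqxx big1 ?addr0 // => l.
rewrite -!val_eqE /= => /andP[nlS nl].
by rewrite eq_sym (negPf nlS) eqSS eq_sym (negPf nl) mul0mx.
Qed.

(** Multiplying out leaves only three block diagonals. As [d] is not assumed symmetric here, the
    subdiagonal and the superdiagonal give separate equations. *)
Lemma block_ldlE (R : realType) (m : nat) (alpha beta ell d : nat -> 'M[R]_m)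
    (k : nat) :
  is_block_ldl alpha beta ell d k <->
  (forall i, (i < k)%N -> alpha i.+1 =
     d i.+1 + (if i is i'.+1 then ell i *m d i *m (ell i)^T else 0)) /\
  (forall i, (0 < i < k)%N ->
     beta i.+1 = ell i *m d i /\ (beta i.+1)^T = d i *m (ell i)^T).
Proof.
pose T (i j : nat) : 'M[R]_m :=
  if i == j then alpha i.+1 else if i == j.+1 then beta i.+1
  else if j == i.+1 then (beta j.+1)^T else 0.
pose L := bidiag_entry ell.
(* The block of [L D L^T] at position (i, j), with the sum over row i of [L] reduced to its two
   possibly nonzero terms. *)
pose E i j := d i.+1 *m (L j i)^T +
  (if i is i'.+1 then ell i *m (d i'.+1 *m (L j i')^T) else 0).
have LE i j : (i < k)%N ->
    \sum_(l < k) (L i l *m d l.+1) *m (L j l)^T = E i j.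
  move=> ltik.
  apply: etrans (sum_bidiag_entry ell (fun l => d l.+1 *m (L j l)^T) ltik).
  by apply: eq_bigr => l _; rewrite mulmxA.
have -> : is_block_ldl alpha beta ell d k <->
    forall i j, (i < k)%N -> (j < k)%N -> T i j = E i j.
  rewrite /is_block_ldl /block_tridiag /block_bidiag /block_diag.
  rewrite mul_mxblock_mxdiag tr_mxblock mul_mxblock -eq_mxblockP.
  split=> [TE i j ltik ltjk|TE i j]; last first.
    exact: etrans (TE _ _ (ltn_ord i) (ltn_ord j)) (esym (LE i j (ltn_ord i))).
  exact: etrans (TE (Ordinal ltik) (Ordinal ltjk)) (LE i j ltik).
have Eii i : E i i = d i.+1 + (if i is i'.+1 then ell i *m d i *m (ell i)^T else 0).
  rewrite /E /L /bidiag_entry eqxx trmx1 mulmx1; congr (_ + _); case: i => // i.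
  by rewrite (gtn_eqF (ltnSn i)) eqxx mulmxA.
have ESi i : E i.+1 i = ell i.+1 *m d i.+1.
  rewrite /E /L /bidiag_entry eqxx trmx1 mulmx1.
  by rewrite (ltn_eqF (ltnSn i)) (ltn_eqF (ltnW (ltnSn i.+1))) trmx0 mulmx0 add0r.
have EiS i : E i i.+1 = d i.+1 *m (ell i.+1)^T.
  rewrite /E /L /bidiag_entry eqxx (gtn_eqF (ltnSn i)).
  case: i => [|i]; first by rewrite addr0.
  rewrite (gtn_eqF (ltnW (ltnSn i.+1))) eqSS (gtn_eqF (ltnSn i)).
  by rewrite trmx0 !mulmx0 addr0.
split=> [TE|[aE bE] i j ltik ltjk].
  split=> [i ltik|[//|i] /= ltik].
    by have := TE i i ltik ltik; rewrite {1}/T eqxx Eii.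
  rewrite -ESi -EiS; split.
    rewrite -(TE i.+1 i) ?(ltnW ltik) // /T (gtn_eqF (ltnSn i)) eqxx //.
  rewrite -(TE i i.+1) ?(ltnW ltik) // /T (ltn_eqF (ltnSn i)) eqxx.
  by rewrite (ltn_eqF (ltnW (ltnSn i.+1))).
rewrite /T; case: eqVneq => [<-|nij]; first by rewrite Eii aE.
case: eqVneq => [ij|niSj].
  by move: ltik; rewrite ij ESi => ltik; have [] := bE j.+1 ltik.
case: (eqVneq j i.+1) => [ji|njSi].
  by move: ltjk; rewrite ji EiS => ltjk; have [] := bE i.+1 ltjk.
(* Off the three diagonals, both terms of [E] vanish. *)
rewrite /E /L /bidiag_entry eq_sym (negPf nij) (negPf njSi) trmx0 mulmx0 add0r.
case: i nij niSj {ltik njSi} => // i nij niSj.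
rewrite [j == i]eq_sym -eqSS (negPf niSj) [j == _]eq_sym (negPf nij).
by rewrite trmx0 !mulmx0.
Qed.

(** Block elimination from the top: [d_j] is known, [beta_{j+1} = ell_j d_j] gives [ell_j], and the
    next diagonal equation gives [d_{j+1}]. Only pivots before the last are divided by. *)
Lemma block_ldl_uniq (R : realType) (m : nat)
    (alpha beta ell d ell' d' : nat -> 'M[R]_m) (k : nat) :
  (forall j, (0 < j < k)%N -> d j \in unitmx) ->
  is_block_ldl alpha beta ell d k -> is_block_ldl alpha beta ell' d' k ->
  (forall j, (1 <= j <= k)%N -> d' j = d j) /\
  (forall j, (1 <= j < k)%N -> ell' j = ell j).
Proof.
move=> ud /block_ldlE[aE bE] /block_ldlE[aE' bE'].
have ellE j : (1 <= j < k)%N -> d' j = d j -> ell' j = ell j.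
  move=> jk dj; rewrite -[LHS](mulmxK (ud j jk)) -[RHS](mulmxK (ud j jk)).
  by rewrite -{1}dj -(bE' j jk).1 (bE j jk).1.
have dE j : (1 <= j <= k)%N -> d' j = d j.
  case: j => // j; elim: j => [|j IHj] /= ltjk.
    by have := aE 0%N ltjk; rewrite (aE' 0%N ltjk) !addr0.
  have dj := IHj (ltnW ltjk); have := aE j.+1 ltjk.
  by rewrite (aE' j.+1 ltjk) dj (ellE j.+1 ltjk dj) => /addIr.
by split=> // j jk; apply: ellE => //; apply: dE; case/andP: jk => -> /ltnW.
Qed.

(** * Orthogonality and rank of the OL-BCG residuals *)

Lemma olbcg_rS (R : realType) (n m : nat) (A : 'M[R]_n) (b x0 : 'M[R]_(n, m))
    (phi : nat -> 'M[R]_m) (j : nat) :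
  olbcg_r A b x0 phi j.+1 =
  olbcg_r A b x0 phi j - A *m olbcg_p A b x0 phi j *m olbcg_gamma A b x0 phi j.
Proof.
by rewrite /olbcg_gamma /olbcg_r /olbcg_p /=; case: (olbcg A b x0 phi j) => [[]].
Qed.

(** With this indexing, the value at j is the coefficient [delta_{j+1}] of the algorithm. *)
Definition olbcg_delta (R : realType) (n m : nat) (A : 'M[R]_n)
    (b x0 : 'M[R]_(n, m)) (phi : nat -> 'M[R]_m) (j : nat) : 'M[R]_m :=
  let r := olbcg_r A b x0 phi in
  invmx (phi j) *m invmx ((r j)^T *m r j) *m ((r j.+1)^T *m r j.+1).

Lemma olbcg_pS (R : realType) (n m : nat) (A : 'M[R]_n) (b x0 : 'M[R]_(n, m))
    (phi : nat -> 'M[R]_m) (j : nat) :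
  olbcg_p A b x0 phi j.+1 =
  (olbcg_r A b x0 phi j.+1 + olbcg_p A b x0 phi j *m olbcg_delta A b x0 phi j)
  *m phi j.+1.
Proof.
by rewrite /olbcg_delta /olbcg_r /olbcg_p /=; case: (olbcg A b x0 phi j) => [[]].
Qed.

Lemma row_free_of_mulmx_unit (R : fieldType) (n m : nat) (B C : 'M[R]_(n, m)) :
  B^T *m C \in unitmx -> row_free B^T.
Proof.
move=> uBC; apply/row_freeP; exists (C *m invmx (B^T *m C)).
by rewrite mulmxA mulmxV.
Qed.

(** The right-hand side is invertible, so [p^T] has a right inverse. *)
Lemma olbcg_p_free (R : realType) (n m : nat) (phi : 'M[R]_m) (r p : 'M[R]_(n, m)) :
  phi \in unitmx -> row_free r^T ->
  p^T *m r = phi^T *m (r^T *m r) -> row_free p^T.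
Proof.
move=> uphi fr pr; apply: (@row_free_of_mulmx_unit _ _ _ _ r); rewrite pr.
by rewrite unitmx_mul unitmx_tr uphi posdef_unit //; apply: posdef_gram.
Qed.

Lemma olbcg_gamma_unit (R : realType) (n m : nat) (A : 'M[R]_n) (phi : 'M[R]_m)
    (r p : 'M[R]_(n, m)) :
  posdef A -> phi \in unitmx -> row_free r^T -> row_free p^T ->
  olbcg_gamma_of A phi r p \in unitmx.
Proof.
move=> pA uphi fr fp; rewrite /olbcg_gamma_of !unitmx_mul unitmx_inv unitmx_tr uphi.
rewrite (posdef_unit (posdef_congr pA fp)) /=.
exact: posdef_unit (posdef_gram fr).
Qed.

(** The two equations on [r] and [p] say that [p - r phi] is orthogonal to [r] and [A]-orthogonal to
    [p]. This local information is preserved by one step and already yields orthogonality of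
    consecutive residuals. *)
Lemma olbcg_orth_step (R : realType) (n m : nat) (A : 'M[R]_n)
    (phi phi' : 'M[R]_m) (r p : 'M[R]_(n, m)) :
  posdef A -> phi \in unitmx -> row_free r^T ->
  p^T *m r = phi^T *m (r^T *m r) ->
  phi^T *m r^T *m A *m p = p^T *m A *m p ->
  let gamma := olbcg_gamma_of A phi r p in
  let r' := r - A *m p *m gamma in
  let delta := invmx phi *m invmx (r^T *m r) *m (r'^T *m r') in
  let p' := (r' + p *m delta) *m phi' in
  [/\ r^T *m r' = 0, p'^T *m r' = phi'^T *m (r'^T *m r')
    & phi'^T *m r'^T *m A *m p' = p'^T *m A *m p'].
Proof.
move=> pA uphi fr pr rAp gamma r' delta p'.
have fp := olbcg_p_free uphi fr pr.
have pP := posdef_congr pA fp; have pN := posdef_gram fr.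
have uN := posdef_unit pN; have uP := posdef_unit pP; have uphiT := uphi.
rewrite -unitmx_tr in uphiT.
have pAE : A^T = A by case: pA.
have NT : (r^T *m r)^T = r^T *m r by case: pN.
have PT : (p^T *m A *m p)^T = p^T *m A *m p by case: pP.
have ugamma : gamma \in unitmx by exact: olbcg_gamma_unit.
have PE : p^T *m A *m p *m gamma = phi^T *m (r^T *m r).
  by rewrite /gamma /olbcg_gamma_of -(mulmxA (invmx _)) mulKVmx.
move: gamma ugamma PE @r' @delta @p' => gamma ugamma PE r' delta p'.
(* The choice of [gamma] makes the new residual orthogonal to the old direction. *)
have pr' : p^T *m r' = 0 by rewrite mulmxBr !mulmxA PE pr -?mulmxA subrr.
have rr'E : r - r' = A *m p *m gamma by rewrite opprB addrC subrK.
have rr' : r^T *m r' = 0.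
  rewrite -[LHS](mulKmx uphiT) mulmxBr mulmxBr !mulmxA rAp PE.
  by rewrite !mulmxA subrr mulmx0.
move: r' rr' pr' rr'E @delta @p' => r' rr' pr' rr'E delta p'.
(* The choice of [delta] gives conjugacy of consecutive directions: after multiplication by
   [gamma^T], the factor [A p gamma] can be replaced by [r - r']. *)
have pAp' : p^T *m A *m (r' + p *m delta) = 0.
  have ugT : gamma^T \in unitmx by rewrite unitmx_tr.
  rewrite -[LHS](mulKmx ugT) mulmxDr mulmxDr.
  have -> : gamma^T *m (p^T *m A *m r') = - (r'^T *m r').
    have -> : gamma^T *m (p^T *m A *m r') = (r - r')^T *m r'.
      by rewrite rr'E !trmx_mul pAE !mulmxA.
    by rewrite [(r - r')^T]linearB /= mulmxBl rr' sub0r.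
  suff -> : gamma^T *m (p^T *m A *m (p *m delta)) = r'^T *m r'.
    by rewrite addNr mulmx0.
  have -> : gamma^T *m (p^T *m A *m (p *m delta)) =
      (p^T *m A *m p *m gamma)^T *m delta.
    by rewrite trmx_mul PT !mulmxA.
  rewrite PE trmx_mul trmxK NT /delta !mulmxA mulmxK //.
  by rewrite mulmxV // mul1mx.
split=> //.
  rewrite trmx_mul -mulmxA linearD mulmxDl /= trmx_mul.
  by rewrite -[_ *m _ *m r']mulmxA pr' mulmx0 addr0.
have p'T : p'^T = phi'^T *m r'^T + phi'^T *m delta^T *m p^T.
  by rewrite trmx_mul [(r' + _)^T]linearD /= mulmxDr (trmx_mul p) mulmxA.
rewrite p'T !mulmxDl -[LHS]addr0; congr (_ + _).
rewrite -!mulmxA (mulmxA A) (mulmxA p^T) (mulmxA p^T) pAp'.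
by rewrite mul0mx !mulmx0.
Qed.

Lemma olbcg_inv (R : realType) (n m : nat) (A : 'M[R]_n) (b x0 : 'M[R]_(n, m))
    (phi : nat -> 'M[R]_m) (j : nat) :
  let r := olbcg_r A b x0 phi in
  let p := olbcg_p A b x0 phi in
  posdef A -> (forall i, phi i \in unitmx) ->
  (forall i, (i < j)%N -> row_free (r i)^T) ->
  (p j)^T *m r j = (phi j)^T *m ((r j)^T *m r j) /\
  (phi j)^T *m (r j)^T *m A *m p j = (p j)^T *m A *m p j.
Proof.
move=> r p pA uphi; elim: j => [|j IHj] fr.
  by rewrite /r /p /olbcg_r /olbcg_p /= trmx_mul !mulmxA.
have [i ltij|pr rAp] := IHj; first exact: (fr _ (ltnW ltij)).
have [_] := olbcg_orth_step (phi j.+1) pA (uphi j) (fr j (ltnSn j)) pr rAp.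
by rewrite /r /p olbcg_pS /olbcg_delta olbcg_rS.
Qed.

Lemma olbcg_orth (R : realType) (n m : nat) (A : 'M[R]_n) (b x0 : 'M[R]_(n, m))
    (phi : nat -> 'M[R]_m) (j : nat) :
  let r := olbcg_r A b x0 phi in
  posdef A -> (forall i, phi i \in unitmx) ->
  (forall i, (i <= j)%N -> row_free (r i)^T) ->
  (r j)^T *m r j.+1 = 0.
Proof.
move=> r pA uphi fr.
have [i ltij|pr rAp] := olbcg_inv (b := b) (x0 := x0) (j := j) pA uphi.
  exact/fr/ltnW.
have [rr _ _] := olbcg_orth_step (phi j) pA (uphi j) (fr j (leqnn j)) pr rAp.
by rewrite {2}/r olbcg_rS.
Qed.

Lemma mxrank_sums_ord_le (F : fieldType) (n m : nat) (B : nat -> 'M[F]_(m, n))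
    (j : nat) :
  (\rank (\sum_(i < j) <<B i>>)%MS <= j * m)%N.
Proof.
elim: j => [|j IHj]; first by rewrite big_ord0 mxrank0.
rewrite big_ord_recr /= (leq_trans (mxrank_adds_leqif _ _)) // mulSnr.
by rewrite leq_add // mxrank_gen rank_leq_row.
Qed.

(** Each block adds at most m to the rank, so the maximal total forces every contribution to be
    maximal. *)
Lemma mxrank_sums_ord_full (F : fieldType) (n m : nat) (B : nat -> 'M[F]_(m, n))
    (j : nat) :
  \rank (\sum_(i < j.+1) <<B i>>)%MS = (j.+1 * m)%N ->
  \rank (\sum_(i < j) <<B i>>)%MS = (j * m)%N /\ row_free (B j).
Proof.
rewrite big_ord_recr /= => rB.
have := mxrank_adds_leqif (\sum_(i < j) <<B i>>)%MS <<B j>>%MS.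
rewrite {}rB mxrank_gen => -[+ _].
have := mxrank_sums_ord_le B j; have := rank_leq_row (B j).
rewrite mulSnr /row_free; move: (\rank _) (\rank (B j)) => y x xm yjm h.
have xE : x = m.
  apply/eqP; rewrite eqn_leq xm -(leq_add2l (j * m)) (leq_trans h) //.
  by rewrite leq_add2r.
split; last exact/eqP.
by apply/eqP; rewrite eqn_leq yjm -(leq_add2r m) (leq_trans h) // xE.
Qed.

Lemma krylov_rank_prefix (R : realType) (n m : nat) (A : 'M[R]_n)
    (v : 'M[R]_(n, m)) (k j : nat) :
  \rank (krylov A v k) = (k * m)%N -> (j <= k)%N ->
  \rank (krylov A v j) = (j * m)%N.
Proof.
elim: k => [|k IHk]; first by move=> ?; rewrite leqn0 => /eqP->.
move=> rk; rewrite leq_eqVlt => /predU1P[->//|]; rewrite ltnS; apply: IHk.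
by have [] := mxrank_sums_ord_full (B := fun i => (A ^+ i *m v)^T) rk.
Qed.

Definition residual_span (R : realType) (n m : nat) (A : 'M[R]_n)
    (b x0 : 'M[R]_(n, m)) (phi : nat -> 'M[R]_m) (j : nat) : 'M[R]_n :=
  (\sum_(i < j) <<(olbcg_r A b x0 phi i)^T>>)%MS.

Lemma residual_span_sup (R : realType) (n m : nat) (A : 'M[R]_n)
    (b x0 : 'M[R]_(n, m)) (phi : nat -> 'M[R]_m) (i j : nat) :
  (i < j)%N -> ((olbcg_r A b x0 phi i)^T <= residual_span A b x0 phi j)%MS.
Proof.
by move=> ltij; apply: (sumsmx_sup (Ordinal ltij)); rewrite // genmxE.
Qed.

Lemma residual_spanS (R : realType) (n m : nat) (A : 'M[R]_n)
    (b x0 : 'M[R]_(n, m)) (phi : nat -> 'M[R]_m) (i j : nat) :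
  (i <= j)%N -> (residual_span A b x0 phi i <= residual_span A b x0 phi j)%MS.
Proof.
move=> leij; apply/sumsmx_subP => l _; rewrite genmxE residual_span_sup //.
exact: leq_trans leij.
Qed.

Lemma olbcg_p_span (R : realType) (n m : nat) (A : 'M[R]_n)
    (b x0 : 'M[R]_(n, m)) (phi : nat -> 'M[R]_m) (j : nat) :
  ((olbcg_p A b x0 phi j)^T <= residual_span A b x0 phi j.+1)%MS.
Proof.
elim: j => [|j IHj].
  rewrite (_ : olbcg_p _ _ _ _ _ = olbcg_r A b x0 phi 0 *m phi 0%N) //.
  by rewrite trmx_mul mulmx_sub // residual_span_sup.
rewrite olbcg_pS trmx_mul mulmx_sub // linearD addmx_sub ?residual_span_sup //=.
by rewrite trmx_mul mulmx_sub // (submx_trans IHj) // residual_spanS.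
Qed.

(** Each [r_i] is a combination of [p_i] and [p_{i-1}], while [A p_i] is
    [(r_i - r_{i+1}) gamma_i^-1]. In the transposed encoding, applying [A] is right multiplication
    by [A^T]. *)
Lemma residual_span_mul (R : realType) (n m : nat) (A : 'M[R]_n)
    (b x0 : 'M[R]_(n, m)) (phi : nat -> 'M[R]_m) (j : nat) :
  posdef A -> (forall i, phi i \in unitmx) ->
  (forall i, (i < j)%N -> row_free (olbcg_r A b x0 phi i)^T) ->
  (residual_span A b x0 phi j *m A^T <= residual_span A b x0 phi j.+1)%MS.
Proof.
move=> pA uphi fr; set r := olbcg_r A b x0 phi in fr *; set p := olbcg_p A b x0 phi.
have Ap i : (i < j)%N -> ((A *m p i)^T <= residual_span A b x0 phi j.+1)%MS.
  move=> ltij; have [l ltli|pr _] := olbcg_inv (b := b) (x0 := x0) (j := i) pA uphi.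
    exact/fr/(ltn_trans ltli).
  have fp := olbcg_p_free (uphi i) (fr i ltij) pr.
  have ug := olbcg_gamma_unit pA (uphi i) (fr i ltij) fp.
  rewrite -[A *m p i](mulmxK ug) trmx_mul mulmx_sub //.
  have -> : A *m p i *m olbcg_gamma_of A (phi i) (r i) (p i) = r i - r i.+1.
    by rewrite /r olbcg_rS opprB addrC subrK.
  by rewrite linearB addmx_sub ?eqmx_opp ?residual_span_sup // ltnW.
rewrite sumsmxMr; apply/sumsmx_subP => -[i ltij] _ /=.
rewrite (eqmxMr _ (genmxE _)) -trmx_mul -/r.
case: i ltij => [|i] ltij.
  rewrite -[r 0%N](mulmxK (uphi 0%N)) (_ : r 0%N *m phi 0%N = p 0%N) // mulmxA.
  by rewrite trmx_mul mulmx_sub // Ap.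
have -> : r i.+1 = p i.+1 *m invmx (phi i.+1) - p i *m olbcg_delta A b x0 phi i.
  by rewrite /p olbcg_pS mulmxK // addrK.
rewrite mulmxBr (mulmxA A (p i.+1)) (mulmxA A (p i)) linearB.
rewrite addmx_sub ?eqmx_opp //=.
  by rewrite trmx_mul mulmx_sub // Ap.
by rewrite trmx_mul mulmx_sub // Ap // ltnW.
Qed.

Lemma olbcg_r_free (R : realType) (n m : nat) (A : 'M[R]_n)
    (b x0 : 'M[R]_(n, m)) (phi : nat -> 'M[R]_m) (k j : nat) :
  posdef A -> (forall i, phi i \in unitmx) ->
  \rank (krylov A (b - A *m x0) k) = (k * m)%N -> (j < k)%N ->
  row_free (olbcg_r A b x0 phi j)^T.
Proof.
move=> pA uphi rk; set r0 := b - A *m x0 in rk *.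
set r := olbcg_r A b x0 phi; set M := residual_span A b x0 phi.
(* Full rank of all earlier residuals is carried along because [residual_span_mul] asks for it. The
   inclusion bounds the dimension of the residual span below by that of the Krylov space, which
   forces the last residual to have full rank. *)
suff IH i : (i < k)%N -> (krylov A r0 i.+1 <= M i.+1)%MS /\
    forall l, (l <= i)%N -> row_free (r l)^T.
  by move=> /IH[_]; apply.
elim: i => [|i IHi] ltik.
- have KM : (krylov A r0 1 <= M 1%N)%MS.
    rewrite /krylov /M /residual_span !big_ord1 expr0.
    by rewrite (_ : 1 *m r0 = r 0%N) //; apply: mul1mx.
  split=> // l; rewrite leqn0 => /eqP->.
  suff /(mxrank_sums_ord_full (B := fun u => (r u)^T))[] :
    \rank (M 1%N) = (1 * m)%N by [].
  apply/eqP; rewrite eqn_leq (mxrank_sums_ord_le (fun u => (r u)^T)).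
  by rewrite -(krylov_rank_prefix rk ltik) mxrankS.
- have [KM fr] := IHi (ltnW ltik).
  have KM' : (krylov A r0 i.+2 <= M i.+2)%MS.
    apply/sumsmx_subP => -[[|l] ltl] _ /=; rewrite genmxE.
      by rewrite (_ : _ *m r0 = r 0%N) ?residual_span_sup //; apply: mul1mx.
    rewrite exprS -mulmxA trmx_mul.
    apply: submx_trans (residual_span_mul pA uphi _); last by move=> u /fr.
    apply: submxMr; apply: submx_trans KM.
    by apply: (sumsmx_sup (Ordinal (ltl : (l < i.+1)%N))); rewrite // genmxE.
  split=> // l; rewrite leq_eqVlt => /predU1P[->|]; last by rewrite ltnS => /fr.
  suff /(mxrank_sums_ord_full (B := fun u => (r u)^T))[] :
    \rank (M i.+2) = (i.+2 * m)%N by [].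
  apply/eqP; rewrite eqn_leq (mxrank_sums_ord_le (fun u => (r u)^T)).
  by rewrite -(krylov_rank_prefix rk ltik) mxrankS.
Qed.

(** * From OL-BCG to block Lanczos *)

(* The recurrence for d hides its symmetry, which this congruence exhibits. *)
Lemma ol_d_congr (R : realType) (n m : nat) (A : 'M[R]_n) (phi sigma theta : 'M[R]_m)
    (r p : 'M[R]_(n, m)) :
  p^T *m A *m p \in unitmx -> phi \in unitmx -> is_chol (r^T *m r) sigma ->
  let X := invmx phi *m invmx sigma *m theta in
  theta^T *m sigma *m (invmx (olbcg_gamma_of A phi r p) *m invmx phi
    *m invmx sigma *m theta) = X^T *m (p^T *m A *m p) *m X.
Proof.
move=> uP uphi hs X; have [us NV] := is_chol_gram_inv hs.
have uN : r^T *m r \in unitmx.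
  by have [_ <-] := hs; rewrite unitmx_mul unitmx_tr us.
rewrite /olbcg_gamma_of; move: (p^T *m A *m p) uP => P uP.
have uphiT : phi^T \in unitmx by rewrite unitmx_tr.
rewrite invmxM ?unitmx_mul ?unitmx_inv ?uP ?uphiT // invmxM ?unitmx_inv //.
by rewrite invmxK NV /X !trmx_mul !trmx_inv !mulmxA mulmxK.
Qed.

(* For the residuals this is v_{j+1}; for the directions p_j phi_j^-1 it is the
   (j+1)-st block of the factor S in V = S L^T. *)
Definition ol_block (R : realType) (n m : nat) (r : nat -> 'M[R]_(n, m))
    (sigma theta : nat -> 'M[R]_m) (j : nat) : 'M[R]_(n, m) :=
  (-1) ^+ j *: (r j *m invmx (sigma j) *m theta j).

Lemma scale_signS (R : pzRingType) (V : lmodType R) (j : nat) (x : V) :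
  (-1) ^+ j.+1 *: x = - ((-1) ^+ j *: x).
Proof. by rewrite exprS mulN1r scaleNr. Qed.

(** With [u = A p], this is one block column of [A S = V L D], signs left out. *)
Lemma ol_residual_step (R : realType) (n m : nat) (r r' u : 'M[R]_(n, m))
    (gamma phi sigma sigma' theta theta' tau beta : 'M[R]_m) :
  gamma \in unitmx -> sigma \in unitmx -> sigma' \in unitmx ->
  theta *m theta^T = 1%:M -> sigma' *m tau = theta' *m beta ->
  u *m gamma = r - r' ->
  tau = invmx gamma *m invmx phi *m invmx sigma *m theta ->
  u *m invmx phi *m invmx sigma *m theta =
  r *m invmx sigma *m theta *m (theta^T *m sigma *m tau)
  - r' *m invmx sigma' *m theta' *m beta.
Proof.
move=> ug us us' tt st ug_r tauE.
rewrite -[_ *m theta' *m beta]mulmxA -st (mulmxA _ sigma') mulmxKV //.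
rewrite !mulmxA -[_ *m theta *m theta^T]mulmxA tt mulmx1 mulmxKV //.
by rewrite -mulmxBl -ug_r tauE !mulmxA mulmxK.
Qed.

(** With [s = p phi^-1], the left side is the next normalized direction and the identity is one
    block column of [V = S L^T], signs left out. *)
Lemma ol_direction_step (R : realType) (n m : nat) (r' s : 'M[R]_(n, m))
    (N sigma sigma' theta theta' : 'M[R]_m) :
  is_chol N sigma -> sigma' \in unitmx -> theta *m theta^T = 1%:M ->
  (r' + s *m invmx N *m (sigma'^T *m sigma')) *m invmx sigma' *m theta' =
  r' *m invmx sigma' *m theta'
  + s *m invmx sigma *m theta *m (theta'^T *m sigma' *m invmx sigma *m theta)^T.
Proof.
move=> /is_chol_gram_inv[us ->] us' tt; rewrite !mulmxDl; congr (_ + _).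
rewrite !trmx_mul trmxK !mulmxA mulmxK //.
by rewrite -[_ *m theta *m theta^T]mulmxA tt mulmx1.
Qed.

Lemma lanczos_vS (R : realType) (n m : nat) (A : 'M[R]_n) (v : 'M[R]_(n, m))
    (j : nat) :
  lanczos_v A v j.+1 = (lanczos A v j).1.2.
Proof.
by rewrite /lanczos_v /=; case: (lanczos A v j) => [[u w] beta] /=; case: (qr _).
Qed.

(** Multiplying the recurrence by [V_j^T] isolates [alpha_{j+1}]. What remains of [w] is already in
    QR form, so [qr] returns exactly [V_{j+1}] and [beta_{j+2}]. Blocks count from 0, so [V_j]
    stands for [v_{j+1}]. *)
Lemma lanczos_of_three_term (R : realType) (n m : nat) (A : 'M[R]_n)
    (v0 : 'M[R]_(n, m)) (V : nat -> 'M[R]_(n, m)) (alpha beta : nat -> 'M[R]_m)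
    (k : nat) :
  let Vprev j := if j is i.+1 then V i else 0 in
  is_qr v0 (V 0%N) (beta 1%N) ->
  (forall j, (j <= k)%N -> (V j)^T *m V j = 1%:M) ->
  (forall j, (j < k)%N ->
     [/\ (V j)^T *m V j.+1 = 0, upper_pos (beta j.+2)
       & A *m V j =
         Vprev j *m (beta j.+1)^T + V j *m alpha j.+1 + V j.+1 *m beta j.+2]) ->
  (forall j, (j <= k)%N -> lanczos A v0 j = (Vprev j, V j, beta j.+1)) /\
  (forall j, (j < k)%N ->
     lanczos_alpha_of A (Vprev j) (V j) (beta j.+1) = alpha j.+1 /\
     is_qr (lanczos_w_of A (Vprev j) (V j) (beta j.+1)) (V j.+1) (beta j.+2)).
Proof.
move=> Vprev qr0 VV step.
have loc j : (j < k)%N ->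
    lanczos_alpha_of A (Vprev j) (V j) (beta j.+1) = alpha j.+1 /\
    is_qr (lanczos_w_of A (Vprev j) (V j) (beta j.+1)) (V j.+1) (beta j.+2).
  move=> ltjk; have [VVS pb AV] := step j ltjk.
  have wE : A *m V j - Vprev j *m (beta j.+1)^T =
      V j *m alpha j.+1 + V j.+1 *m beta j.+2.
    by apply/eqP; rewrite subr_eq AV -addrA addrC.
  have aE : lanczos_alpha_of A (Vprev j) (V j) (beta j.+1) = alpha j.+1.
    rewrite /lanczos_alpha_of wE mulmxDr !mulmxA VV ?(ltnW ltjk) //.
    by rewrite VVS mul1mx mul0mx addr0.
  split=> //; split; [|exact: VV|exact: pb].
  by rewrite /lanczos_w_of aE wE addrC addKr.
split=> //; elim=> [|j IHj] ltjk /=; first by rewrite (qrE qr0).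
by rewrite IHj ?(ltnW ltjk) // (qrE (loc j ltjk).2).
Qed.

Theorem theorem2 (R : realType) (n m : nat) (A : 'M[R]_n)
    (b x0 : 'M[R]_(n, m)) (phi : nat -> 'M[R]_m) (k : nat)
    (tau d alpha sigma theta beta ell : nat -> 'M[R]_m) :
  let r0 := b - A *m x0 in
  let r := olbcg_r A b x0 phi in
  let p := olbcg_p A b x0 phi in
  let gamma := olbcg_gamma A b x0 phi in
  let v := lanczos_v A r0 in
  let alphaL := lanczos_alpha A r0 in
  let betaL := lanczos_beta A r0 in
  posdef A ->
  (forall j, phi j \in unitmx) ->
  (1 <= k)%N ->
  \rank (krylov A r0 k.+1) = (k.+1 * m)%N ->
  sigma 0%N = chol (r0^T *m r0) ->
  beta 1%N = sigma 0%N ->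
  theta 0%N = 1%:M ->
  ell 0%N = 0 ->
  (forall j, (1 <= j <= k)%N ->
     [/\ tau j = invmx (gamma j.-1) *m invmx (phi j.-1) *m
                 invmx (sigma j.-1) *m theta j.-1,
         d j = (theta j.-1)^T *m sigma j.-1 *m tau j
       & alpha j = d j + ell j.-1 *m (beta j)^T] /\
     [/\ sigma j = chol ((r j)^T *m r j),
         (theta j, beta j.+1) = qr (sigma j *m tau j)
       & ell j = (theta j)^T *m sigma j *m invmx (sigma j.-1) *m theta j.-1]) ->
  [/\ (* no breakdown in either algorithm *)
      is_qr r0 (v 1%N) (betaL 1%N) /\
      (forall j, (1 <= j <= k)%N ->
         [/\ is_qr (lanczos_w A r0 j) (v j.+1) (betaL j.+1),
             (p j.-1)^T *m A *m p j.-1 \in unitmx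
           & (r j.-1)^T *m r j.-1 \in unitmx]),
      (* no breakdown in the recurrences *)
      is_chol (r0^T *m r0) (sigma 0%N) /\
      (forall j, (1 <= j <= k)%N ->
         [/\ gamma j.-1 \in unitmx, sigma j.-1 \in unitmx,
             is_chol ((r j)^T *m r j) (sigma j)
           & is_qr (sigma j *m tau j) (theta j) (beta j.+1)]),
      (* Lanczos coefficients *)
      (forall j, (1 <= j <= k)%N ->
         alphaL j = alpha j /\ betaL j.+1 = beta j.+1),
      (* T_k = L_k D_k L_k^T, and its extension to T_{k+1}, which holds ell_k *)
      [/\ is_block_ldl alphaL betaL ell d k,
          (forall ell' d' : nat -> 'M[R]_m,
             is_block_ldl alphaL betaL ell' d' k ->
             (forall j, (1 <= j <= k)%N -> d' j = d j) /\
             (forall j, (1 <= j < k)%N -> ell' j = ell j)),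
          (exists2 d' : nat -> 'M[R]_m,
             is_block_ldl alphaL betaL ell d' k.+1
             & forall j, (1 <= j <= k)%N -> d' j = d j)
        & (forall ell' d' : nat -> 'M[R]_m,
             is_block_ldl alphaL betaL ell' d' k.+1 ->
             forall j, (1 <= j <= k)%N -> d' j = d j /\ ell' j = ell j)]
    & [/\ sigma k \in unitmx, theta k \in unitmx
        & v k.+1 = (-1) ^+ k *: (r k *m invmx (sigma k) *m (invmx (theta k))^T)]].
Proof.
move=> r0 r p gamma v alphaL betaL pA uphi k_gt0 rk sigma0 beta1 theta0 ell0 rec.
have fr j : (j <= k)%N -> row_free (r j)^T.
  by move=> lejk; apply: (olbcg_r_free (k := k.+1)).
have pr j : (j <= k)%N -> (p j)^T *m r j = (phi j)^T *m ((r j)^T *m r j).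
  move=> lejk.
  have [|//] := olbcg_inv (b := b) (x0 := x0) (j := j) pA uphi.
  by move=> i ltij; apply/fr/(leq_trans (ltnW ltij)).
have fp j : (j <= k)%N -> row_free (p j)^T.
  by move=> lejk; apply: olbcg_p_free (uphi j) (fr j lejk) (pr j lejk).
have pP j : (j <= k)%N -> posdef ((p j)^T *m A *m p j).
  by move=> lejk; apply: posdef_congr (fp j lejk).
have uP j (lejk : (j <= k)%N) := posdef_unit (pP j lejk).
have uN j (lejk : (j <= k)%N) := posdef_unit (posdef_gram (fr j lejk)).
have ug j : (j <= k)%N -> gamma j \in unitmx.
  by move=> lejk; apply: olbcg_gamma_unit (uphi j) (fr j lejk) (fp j lejk).
have rr j : (j < k)%N -> (r j)^T *m r j.+1 = 0.
  move=> ltjk; apply: olbcg_orth => // i leij.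
  exact/fr/(leq_trans leij)/ltnW.
(* The recurrences are shifted by one index, which removes the predecessors. *)
have tauE j (ltjk : (j < k)%N) : tau j.+1 = _ :=
  let: conj (And3 e _ _) _ := rec j.+1 ltjk in e.
have dE j (ltjk : (j < k)%N) : d j.+1 = _ :=
  let: conj (And3 _ e _) _ := rec j.+1 ltjk in e.
have alphaE j (ltjk : (j < k)%N) : alpha j.+1 = _ :=
  let: conj (And3 _ _ e) _ := rec j.+1 ltjk in e.
have thetaE j (ltjk : (j < k)%N) : (theta j.+1, beta j.+2) = _ :=
  let: conj _ (And3 _ e _) := rec j.+1 ltjk in e.
have ellE j (ltjk : (j < k)%N) : ell j.+1 = _ :=
  let: conj _ (And3 _ _ e) := rec j.+1 ltjk in e.
move=> /= in tauE dE alphaE thetaE ellE.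
have hs j : (j <= k)%N -> is_chol ((r j)^T *m r j) (sigma j).
  case: j => [_|j ltjk]; first by rewrite sigma0; apply/cholP/posdef_gram/(fr 0%N).
  have [_ [-> _ _]] := rec j.+1 ltjk.
  exact/cholP/posdef_gram/fr.
have us j : (j <= k)%N -> sigma j \in unitmx by move/hs => [/upper_pos_unit].
(* Invertibility of [theta_j] makes [sigma tau] invertible, so [qr] does not return its default
   value. The condition is discharged by the induction in [tt], which starts at [theta_0 = I]. *)
have qrS j : (j < k)%N -> theta j \in unitmx ->
    is_qr (sigma j.+1 *m tau j.+1) (theta j.+1) (beta j.+2).
  move=> ltjk ut; have lejk := ltnW ltjk.
  have ust : sigma j.+1 *m tau j.+1 \in unitmx.
    by rewrite tauE // !unitmx_mul !unitmx_inv us // ug // uphi us.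
  have := thetaE j ltjk; set B := _ *m _ in ust *.
  case: (qr B) (qrP (B := B)) => Q U /= hqr [-> ->].
  by apply: hqr; rewrite row_free_unit unitmx_tr.
have tt j : (j <= k)%N -> (theta j)^T *m theta j = 1%:M.
  elim: j => [_|j IHj ltjk]; first by rewrite theta0 trmx1 mulmx1.
  by have [] := qrS j ltjk (let: And3 u _ _ := orthomx_unit (IHj (ltnW ltjk)) in u).
have ut j : (j <= k)%N -> theta j \in unitmx by move=> /tt/orthomx_unit[].
have ttT j : (j <= k)%N -> theta j *m (theta j)^T = 1%:M.
  by move=> /tt/orthomx_unit[].
have hqr j (ltjk : (j < k)%N) := qrS j ltjk (ut j (ltnW ltjk)).
(* Congruence by [X] transfers symmetry and invertibility from [p^T A p] to [d]. *)
pose X j := invmx (phi j) *m invmx (sigma j) *m theta j.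
have uX j : (j <= k)%N -> X j \in unitmx.
  by move=> lejk; rewrite !unitmx_mul !unitmx_inv uphi us // ut.
have dX j : (j < k)%N -> d j.+1 = (X j)^T *m ((p j)^T *m A *m p j) *m X j.
  move=> ltjk; have lejk := ltnW ltjk; rewrite dE // tauE //.
  exact: ol_d_congr (uP j lejk) (uphi j) (hs j lejk).
have dT j : (j < k)%N -> (d j.+1)^T = d j.+1.
  move=> ltjk; rewrite dX //.
  have [PT _] := pP j (ltnW ltjk).
  by rewrite trmx_mul (trmx_mul (X j)^T) trmxK PT mulmxA.
have ud j : (j < k)%N -> d j.+1 \in unitmx.
  move=> ltjk; have lejk := ltnW ltjk.
  by rewrite dX // 2!unitmx_mul unitmx_tr uX // uP.
(* The product [ell d] telescopes to [theta^T] times [sigma tau], whose QR factorization leaves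
   [beta]. *)
have betaE j : (j < k)%N -> beta j.+2 = ell j.+1 *m d j.+1.
  move=> ltjk; have lejk := ltnW ltjk.
  have [st _ _] := hqr j ltjk.
  rewrite ellE // dE // !mulmxA -[_ *m theta j *m _]mulmxA ttT // mulmx1.
  rewrite mulmxKV ?us //.
  by rewrite -[_ *m tau _]mulmxA st mulmxA tt // mul1mx.
pose V := ol_block r sigma theta.
pose S := ol_block (fun j => p j *m invmx (phi j)) sigma theta.
(* A S = V L D *)
have AS j : (j < k)%N -> A *m S j = V j *m d j.+1 + V j.+1 *m beta j.+2.
  move=> ltjk; have lejk := ltnW ltjk; have [st _ _] := hqr j ltjk.
  have ApE : A *m p j *m gamma j = r j - r j.+1.
    by rewrite /r olbcg_rS opprB addrC subrK.
  have := ol_residual_step (ug j lejk) (us j lejk) (us _ ltjk) (ttT j lejk)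
    st ApE (tauE j ltjk).
  rewrite -dE // => H.
  rewrite /S /V /ol_block scale_signS mulNmx -!scalemxAl -scalemxAr -scalerBr -H.
  by rewrite !mulmxA.
(* V = S L^T *)
have SS j : (j < k)%N -> V j.+1 = S j.+1 + S j *m (ell j.+1)^T.
  move=> ltjk; have lejk := ltnW ltjk.
  have sE : p j.+1 *m invmx (phi j.+1) = r j.+1 + p j *m invmx (phi j)
      *m invmx ((r j)^T *m r j) *m ((sigma j.+1)^T *m sigma j.+1).
    by rewrite /p olbcg_pS mulmxK // (hs _ ltjk).2 /olbcg_delta !mulmxA.
  have := ol_direction_step (r j.+1) (p j *m invmx (phi j)) (theta j.+1)
    (hs j lejk) (us _ ltjk) (ttT j lejk).
  rewrite -ellE // -sE => H.
  rewrite /S /V /ol_block scale_signS H !scale_signS.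
  by rewrite scalerDr opprD -scalemxAl addrNK.
have VV j : (j <= k)%N -> (V j)^T *m V j = 1%:M.
  move=> lejk; have [_ NE] := hs j lejk.
  rewrite /V /ol_block [(_ *: _)^T]linearZ /= -scalemxAl -scalemxAr scalerA.
  rewrite -expr2 sqrr_sign scale1r !trmx_mul !mulmxA.
  rewrite -[_ *m (r j)^T *m r j]mulmxA -NE !mulmxA mulmxK ?us //.
  by rewrite trmx_inv mulmxKV ?unitmx_tr ?us // tt.
have VVS j : (j < k)%N -> (V j)^T *m V j.+1 = 0.
  move=> ltjk; rewrite /V /ol_block [(_ *: _)^T]linearZ /= -scalemxAl -scalemxAr.
  rewrite !trmx_mul !mulmxA -[_ *m (r j)^T *m r _]mulmxA rr // mulmx0.
  by rewrite !mul0mx !scaler0.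
pose Vprev j := if j is i.+1 then V i else 0.
(* Elimination of [S]: [A] is applied to [V = S L^T], and both resulting columns of [A S] are
   expanded. The two terms in the current block merge into [alpha]. *)
have AV j : (j < k)%N -> A *m V j =
    Vprev j *m (beta j.+1)^T + V j *m alpha j.+1 + V j.+1 *m beta j.+2.
  case: j => [|j] ltjk.
    have VS0 : V 0%N = S 0%N by rewrite /V /S /ol_block mulmxK.
    by rewrite [in LHS]VS0 AS // alphaE // ell0 /= !mul0mx addr0 add0r.
  have ltjk' := ltnW ltjk.
  (* Symmetry of [d] enters here: it turns the superdiagonal of [L D L^T] into [beta^T]. *)
  have dell : d j.+1 *m (ell j.+1)^T = (beta j.+2)^T.
    by rewrite betaE // trmx_mul dT.
  have bell : beta j.+2 *m (ell j.+1)^T = ell j.+1 *m (beta j.+2)^T.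
    by rewrite -dell betaE // mulmxA.
  rewrite [in LHS]SS // mulmxDr (mulmxA A) !AS // mulmxDl.
  rewrite -(mulmxA (V j)) -(mulmxA (V j.+1)) dell bell alphaE //= mulmxDr.
  by rewrite [in RHS]addrA [LHS]addrC [LHS]addrACA addrA.
have qr0 : is_qr r0 (V 0%N) (beta 1%N).
  split; last by rewrite beta1; case: (hs 0%N).
    by rewrite /V /ol_block expr0 scale1r theta0 mulmx1 beta1 mulmxKV ?us.
  exact: VV.
have [] := lanczos_of_three_term qr0 VV (fun j ltjk =>
  And3 (VVS j ltjk) (let: And3 _ _ u := hqr j ltjk in u) (AV j ltjk)).
rewrite -/Vprev => LE loc.
have vS j : (j <= k)%N -> v j.+1 = V j by move=> lejk; rewrite /v lanczos_vS LE.
have vE j : (j <= k)%N -> v j = Vprev j by move=> lejk; rewrite /v /lanczos_v LE.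
have betaLE j : (j <= k)%N -> betaL j.+1 = beta j.+1.
  by move=> lejk; rewrite /betaL /lanczos_beta /= LE.
have alphaLE j : (j < k)%N -> alphaL j.+1 = alpha j.+1.
  move=> ltjk; have lejk := ltnW ltjk; rewrite -(loc j ltjk).1.
  by rewrite /alphaL /lanczos_alpha -/v -/betaL vS // betaLE //= vE.
have wL j : (j < k)%N -> is_qr (lanczos_w A r0 j.+1) (v j.+2) (betaL j.+2).
  move=> ltjk; have lejk := ltnW ltjk; have [_] := loc j ltjk.
  by rewrite /lanczos_w -/v -/betaL /= !vS // vE // !betaLE.
have ldlk : is_block_ldl alphaL betaL ell d k.
  apply/block_ldlE; split=> [j ltjk|[//|j] /= ltjk].
    rewrite alphaLE // alphaE //; congr (_ + _).
    case: j ltjk => [|j] ltjk; first by rewrite ell0 mul0mx.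
    by rewrite (betaE j (ltnW ltjk)) trmx_mul dT ?(ltnW ltjk) // mulmxA.
  have ltjk' := ltnW ltjk.
  by rewrite (betaLE j.+1 ltjk') betaE // trmx_mul dT.
have ud' j : (0 < j <= k)%N -> d j \in unitmx by case: j.
(* The recurrences stop at [alpha_k], so the last pivot of [T_{k+1}] is obtained by solving its
   diagonal equation. *)
pose dnext j := if (j <= k)%N then d j
  else alphaL k.+1 - ell k *m d k *m (ell k)^T.
have dnextE j : (j <= k)%N -> dnext j = d j by rewrite /dnext => ->.
have ldlk1 : is_block_ldl alphaL betaL ell dnext k.+1.
  have [aE _] := (block_ldlE _ _ _ _ _).1 ldlk.
  apply/block_ldlE; split=> [j|[//|j] /=]; rewrite ltnS => lejk.
    move: (lejk); rewrite leq_eqVlt => /predU1P[jk|ltjk]; last first.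
      by rewrite dnextE // dnextE // aE.
    rewrite jk (dnextE k) // /dnext ltnn; case: (k) k_gt0 => // i _.
    by rewrite subrK.
  by rewrite dnextE // (betaLE j.+1 lejk) betaE // trmx_mul dT.
split.
- split=> [|[//|j] /= ltjk]; first by rewrite vS // betaLE.
  by split; [exact: wL | exact/uP/ltnW | exact/uN/ltnW].
- split=> [|[//|j] /= ltjk]; first exact: (hs 0%N).
  by split; [exact/ug/ltnW | exact/us/ltnW | exact: hs | exact: hqr].
- by move=> [//|j] /= ltjk; rewrite alphaLE // betaLE.
- split=> //.
  + move=> ell' d'; apply: block_ldl_uniq ldlk => j /andP[j0 /ltnW jk].
    by apply: ud'; rewrite j0.
  + by exists dnext => // j /andP[_ /dnextE].
  move=> ell' d' ldl' j jk.
  (* Working with [T_{k+1}] brings [ell_k] within reach of uniqueness; the pivots to be inverted are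
     [d_1] to [d_k]. *)
  have [|dE' ellE'] := block_ldl_uniq _ ldlk1 ldl'.
    by move=> i /[dup] ik /andP[_ ltik]; rewrite dnextE // ud'.
  rewrite ellE' // dE' ?dnextE //; first by case/andP: jk.
  by case/andP: jk => -> /leqW.
split; [exact: us | exact: ut |].
by rewrite vS // /V /ol_block; have [_ _ ->] := orthomx_unit (tt k (leqnn k)).
Qed.
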